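(* For every integer $n>1$, every dilation $u\colon(H^n(\mathbb{R}),d_h)\to(H^n(\mathbb{R}),d_h)$ is an isometry.
   Context: The hyperbolic space is $H^n(\mathbb{R})=\mathbb{R}^n$ with the metric $d_h(x,y)=\cosh^{-1}([x][y]-\langle x,y\rangle)$, where $\langle\cdot,\cdot\rangle$ is the standard inner product, $[x]=\sqrt{1+\|x\|^2}$ with $\|\cdot\|$ the Euclidean norm, and $\cosh^{-1}(t)=\log(t+\sqrt{t^2-1})$ for $t\ge1$. A map $f\colon(X,d_X)\to(Y,d_Y)$ is a dilation if there is a constant $c>0$ with $d_Y(f(p),f(q))=c\,d_X(p,q)$ for all $p,q\in X$ (surjectivity is not assumed). An isometry is a surjective distance-preserving map. *)

(* Defs.v *)
From mathcomp Require Import all_boot all_order all_algebra.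
From mathcomp Require Import all_classical all_reals all_analysis.

Set Implicit Arguments.
Unset Strict Implicit.
Unset Printing Implicit Defensive.

Import Order.TTheory GRing.Theory Num.Theory.

Local Open Scope classical_set_scope.
Local Open Scope ring_scope.

Definition is_dilation (R : realType) (X Y : Type)
    (dX : X -> X -> R) (dY : Y -> Y -> R) (f : X -> Y) : Prop :=
  exists2 c : R, 0 < c & forall p q : X, dY (f p) (f q) = c * dX p q.

Definition is_isometry (R : realType) (X Y : Type)
    (dX : X -> X -> R) (dY : Y -> Y -> R) (f : X -> Y) : Prop :=
  (forall p q : X, dY (f p) (f q) = dX p q) /\ set_surj setT setT f.

Section Hyperbolic.
Variables (R : realType) (n : nat).
Implicit Types x y : 'rV[R]_n.

Definition inner x y : R := \sum_(i < n) x 0 i * y 0 i.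

(* The library norm `|x| on row vectors is the sup norm. *)
Definition enorm x : R := Num.sqrt (inner x x).

Definition bracket x : R := Num.sqrt (1 + enorm x ^+ 2).

(* Meaningful only for 1 <= t; the argument used in [dist_h] always satisfies
   this, by the Cauchy-Schwarz inequality. *)
Definition arcosh (t : R) : R := ln (t + Num.sqrt (t ^+ 2 - 1)).

Definition dist_h x y : R := arcosh (bracket x * bracket y - inner x y).

End Hyperbolic.

(* Main.v *)
(* Write Q = cosh d and F s = cosh (c * arcosh s), so that a dilation u of ratio c
   satisfies Q (u x) (u y) = F (Q x y). Midpoints are determined metrically, so u
   preserves them and both medians and their images obey the hyperbolic median
   formula; applied to a right triangle doubled by reflection, this makes F
   multiplicative on [1, +oo). Together with F (2 * s ^+ 2 - 1) = 2 * F s ^+ 2 - 1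
   and monotonicity this forces F 2 = 2, hence c = 1. A map preserving Q is the
   restriction to the hyperboloid of a linear Lorentz map, which is invertible and
   preserves the upper sheet, so u is onto. *)
Require Import Defs.
From mathcomp Require Import all_boot all_order all_algebra.
From mathcomp Require Import all_classical all_reals all_analysis.
From mathcomp Require Import ring lra.

Set Implicit Arguments.
Unset Strict Implicit.
Unset Printing Implicit Defensive.

Import Order.TTheory GRing.Theory Num.Theory.
Local Open Scope ring_scope.

(** * Hyperbolic cosine and its inverse on [[1, +oo)] *)

Section Cosh.
Variable R : realType.
Implicit Types a b c s t : R.

Definition cosh a : R := (expR a + expR (- a)) / 2.

Lemma cosh0 : cosh 0 = 1.
Proof. by rewrite /cosh oppr0 expR0; field. Qed.

Lemma cosh_double a : cosh (2 * a) = 2 * cosh a ^+ 2 - 1.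
Proof.
rewrite /cosh !expRN mulr_natl mulr2n expRD; have := expR_gt0 a.
by move: (expR a) => e e0; field; rewrite gt_eqF.
Qed.

Lemma cosh_lt a b : 0 <= a -> a < b -> cosh a < cosh b.
Proof.
move=> a0 ab; rewrite /cosh !expRN.
have : expR a < expR b by rewrite ltr_expR.
have : 1 <= expR a by rewrite -expR0 ler_expR.
move: (expR a) (expR b) => x y x1 xy.
have xy1 : 1 < x * y by nra.
have x0 : 0 < x by lra.
have y0 : 0 < y by lra.
rewrite -subr_gt0.
(* With [x] and [y] the exponentials of [a] and [b], the difference of the two cosines factors with
   a sign visible from [1 < x * y]. *)
have -> : (y + y^-1) / 2 - (x + x^-1) / 2 = (y - x) * (x * y - 1) / (2 * (x * y)).
  by field; rewrite !gt_eqF.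
by rewrite divr_gt0 ?mulr_gt0// ?subr_gt0// (lt_trans _ xy1).
Qed.

Lemma cosh_le a b : 0 <= a -> a <= b -> cosh a <= cosh b.
Proof.
by move=> a0; rewrite le_eqVlt => /predU1P[->//|/(cosh_lt a0)/ltW].
Qed.

Lemma cosh_inj a b : 0 <= a -> 0 <= b -> cosh a = cosh b -> a = b.
Proof.
move=> a0 b0 e; case: (ltgtP a b) => // /cosh_lt; rewrite e ltxx.
  by move/(_ a0).
by move/(_ b0).
Qed.

Lemma arcosh_arg_ge1 s : 1 <= s -> 1 <= s + Num.sqrt (s ^+ 2 - 1).
Proof. by move=> s1; have := sqrtr_ge0 (s ^+ 2 - 1); lra. Qed.

Lemma arcosh_ge0 s : 1 <= s -> 0 <= arcosh s.
Proof. by move=> s1; rewrite ln_ge0// arcosh_arg_ge1. Qed.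

Lemma arcosh1 : arcosh (1 : R) = 0.
Proof. by rewrite /arcosh expr1n subrr sqrtr0 addr0 ln1. Qed.

Lemma arcosh_gt0 s : 1 < s -> 0 < arcosh s.
Proof.
by move=> s1; rewrite ln_gt0//; have := sqrtr_ge0 (s ^+ 2 - 1); lra.
Qed.

Lemma arcosh_le s t : 1 <= s -> s <= t -> arcosh s <= arcosh t.
Proof.
move=> s1 st; rewrite /arcosh ler_ln ?posrE.
- by rewrite lerD// ler_wsqrtr// lerD2r lerXn2r// ?nnegrE; lra.
- by have := arcosh_arg_ge1 s1; lra.
- by have := arcosh_arg_ge1 (le_trans s1 st); lra.
Qed.

Lemma cosh_arcosh s : 1 <= s -> cosh (arcosh s) = s.
Proof.
move=> s1; have w1 := arcosh_arg_ge1 s1.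
have sq : Num.sqrt (s ^+ 2 - 1) ^+ 2 = s ^+ 2 - 1 by rewrite sqr_sqrtr//; nra.
rewrite /cosh expRN /arcosh lnK ?posrE; last by lra.
move: (Num.sqrt _) w1 sq => r w1 sq.
(* [(s + r) * (s - r) = s ^+ 2 - r ^+ 2 = 1]. *)
have -> : (s + r)^-1 = s - r.
  apply: (@mulfI _ (s + r)); first by rewrite gt_eqF//; lra.
  by rewrite divff ?gt_eqF//; [nra|lra].
by field.
Qed.

Lemma arcosh_double s : 1 <= s -> arcosh (2 * s ^+ 2 - 1) = 2 * arcosh s.
Proof.
move=> s1; apply: cosh_inj.
- by apply: arcosh_ge0; nra.
- by rewrite mulr_ge0// arcosh_ge0.
- by rewrite cosh_double !cosh_arcosh//; nra.
Qed.

End Cosh.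

(** * A functional equation forcing the value 2 at 2 *)

Section DilatedCosh.
Variable R : realType.

Lemma archi_le0 (a b : R) : (forall N : nat, N%:R * a <= b) -> a <= 0.
Proof.
move=> H; rewrite leNgt; apply/negP => a0.
have := H (Num.bound `|b / a|).
rewrite leNgt -ltr_pdivrMr// => /negP; apply.
apply: le_lt_trans (ler_norm _) _; exact: archi_boundP (normr_ge0 _).
Qed.

Lemma bernoulli (x : R) (N : nat) : 0 <= 1 + x -> 1 + N%:R * x <= (1 + x) ^+ N.
Proof.
move=> x1; elim: N => [|N IH]; first by rewrite expr0 mul0r addr0.
rewrite exprS -natr1.
have := ler_wpM2l x1 IH; have := sqr_ge0 x.
by have : 0 <= N%:R :> R by []; nra.
Qed.

(* Comparing [F (2 * s ^+ 2)] with [F (2 * s ^+ 2 - 1)] for large [s]. *)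
Lemma multiplicative_doubling_fix2 (F : R -> R) :
  (forall s t, 1 <= s -> s <= t -> F s <= F t) ->
  (forall s t, 1 <= s -> 1 <= t -> F (s * t) = F s * F t) ->
  (forall s, 1 <= s -> F (2 * s ^+ 2 - 1) = 2 * F s ^+ 2 - 1) ->
  F 1 = 1 -> 1 < F 2 -> F 2 = 2.
Proof.
move=> mono FM F_double F1 F21.
have FX s N : 1 <= s -> F (s ^+ N) = F s ^+ N.
  move=> s1; elim: N => [|N IH]; first by rewrite !expr0.
  by rewrite !exprS FM ?IH// exprn_ege1.
have F_ge1 s : 1 <= s -> 1 <= F s by move=> s1; rewrite -F1 mono.
(* Here [r] is the ratio of [2 * s ^+ 2] to [2 * s ^+ 2 - 1] and [f] is [F s ^+ 2]. As [N] grows,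
   [F r] tends to 1 and [f] to infinity, so the last identity tends to [F 2 = 2]. *)
have key N : exists r f : R, [/\ 1 <= F r, N%:R * (F r - 1) <= F 2 - 1,
    N%:R * (F 2 - 1) <= f & F 2 * f = F r * (2 * f - 1)].
  pose s : R := 2 ^+ N.
  have s1 : 1 <= s by rewrite exprn_ege1//; lra.
  have sN : N%:R <= s ^+ 2.
    have := @bernoulli 1 N; rewrite mulr1 => /(_ ltac:(lra)).
    have -> : (1 + 1 : R) ^+ N = s by congr (_ ^+ _); lra.
    by nra.
  pose d : R := 2 * s ^+ 2 - 1.
  have d1 : 1 <= d by rewrite /d; nra.
  pose r := 2 * s ^+ 2 / d.
  have rd : r * d = 2 * s ^+ 2 by rewrite /r divfK// gt_eqF//; lra.
  have r1 : 1 <= r by rewrite /r ler_pdivlMr /d; nra.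
  (* Bernoulli for [r^-1 = 1 - (2 * s ^+ 2)^-1] gives [r^-1 ^+ N >= 1 / 2], because [N <= s ^+ 2].
     Applying [F] then bounds [F r ^+ N] by [F 2]. *)
  have rN2 : r ^+ N <= 2.
    have rI : r^-1 = 1 - (2 * s ^+ 2)^-1.
      by rewrite /r /d; field; apply/andP; split; rewrite gt_eqF//; nra.
    have := @bernoulli (- (2 * s ^+ 2)^-1) N.
    rewrite -rI invr_ge0 exprVn => /(_ ltac:(lra)).
    have : N%:R * (2 * s ^+ 2)^-1 <= 1 / 2 by rewrite ler_pdivrMr; nra.
    have : 0 < r ^+ N by rewrite exprn_gt0//; lra.
    move: (r ^+ N) => x x0 h1 h2.
    have : 1 / 2 <= x^-1 by lra.
    by move=> h; rewrite -(ler_pM2r (_ : 0 < x^-1)) ?invr_gt0// divff ?gt_eqF//; lra.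
  have Fr1 := F_ge1 _ r1.
  exists r, (F s ^+ 2); split=> //.
  - have := mono _ _ (exprn_ege1 N r1) rN2; rewrite FX//.
    have := @bernoulli (F r - 1) N; rewrite addrC subrK => /(_ ltac:(lra)).
    by lra.
  - rewrite /s FX; last by lra.
    have := @bernoulli (F 2 - 1) N; rewrite addrC subrK => /(_ ltac:(lra)).
    have : 1 <= F 2 ^+ N by rewrite exprn_ege1// ltW.
    move: (F 2 ^+ N) => x x1 xN; have : 0 <= x * (x - 1) by rewrite mulr_ge0; lra.
    by lra.
  - have s21 : 1 <= s * s by nra.
    by rewrite -F_double// -/d -(FM r d)// rd !expr2 -(FM s s)// -FM//; lra.
(* Upper bound: [F 2 <= 2 * F r], so [N * (F 2 - 2)] stays below [2 * (F 2 - 1)]. Lower bound: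
   [f * (2 - F 2) <= 1] while [f] grows at least like [N * (F 2 - 1)]. *)
apply/eqP; rewrite eq_le; apply/andP; split; rewrite -subr_le0.
- apply: (@archi_le0 _ (2 * (F 2 - 1))) => N.
  have [r [f [Fr1 h1 h2 h3]]] := key N.
  have N0 : 0 <= N%:R :> R by [].
  have f0 : 0 <= f by apply: le_trans h2; rewrite mulr_ge0//; lra.
  case: (leP f 0) => [f_le0|f_gt0].
    have f00 : f = 0 by lra.
    by move: h3; rewrite f00; lra.
  have : F 2 <= 2 * F r by rewrite -(ler_pM2r f_gt0); nra.
  by nra.
- apply: (@archi_le0 _ ((F 2 - 1)^-1)) => N.
  have [r [f [Fr1 h1 h2 h3]]] := key N.
  have p0 : 0 < F 2 - 1 by lra.
  rewrite -(ler_pM2r p0) mulVf ?gt_eqF//.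
  have N0 : 0 <= N%:R :> R by [].
  case: (leP (2 - F 2) 0) => [neg|pos].
    have : N%:R * (2 - F 2) <= 0 by nra.
    by move=> h; have := mulr_ge0 N0 (ltW p0); nra.
  have : f * (2 - F 2) <= 1.
    case: (leP (2 * f - 1) 0) => hf; nra.
  by nra.
Qed.

End DilatedCosh.

(** * Inner product, Lorentz form and midpoints on the hyperboloid *)

Section Hyperboloid.
Variables (R : realType) (n : nat).
Implicit Types (x y z p q m r : 'rV[R]_n) (a : R).

Lemma innerC x y : inner x y = inner y x.
Proof. by apply: eq_bigr => i _; rewrite mulrC. Qed.

Lemma innerDl x y z : inner (x + y) z = inner x z + inner y z.
Proof. by rewrite -big_split; apply: eq_bigr => i _; rewrite mxE mulrDl. Qed.

Lemma innerZl a x y : inner (a *: x) y = a * inner x y.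
Proof. by rewrite mulr_sumr; apply: eq_bigr => i _; rewrite mxE mulrA. Qed.

Lemma innerDr x y z : inner x (y + z) = inner x y + inner x z.
Proof. by rewrite innerC innerDl !(innerC x). Qed.

Lemma innerZr a x y : inner x (a *: y) = a * inner x y.
Proof. by rewrite innerC innerZl innerC. Qed.

Lemma inner0l x : inner 0 x = 0.
Proof. by rewrite -(scale0r 0) innerZl mul0r. Qed.

Lemma inner0r x : inner x 0 = 0.
Proof. by rewrite innerC inner0l. Qed.

Lemma inner_delta (i j : 'I_n) :
  inner (delta_mx 0 i) (delta_mx 0 j) = (i == j)%:R :> R.
Proof.
rewrite /inner (bigD1 i)//= big1 => [|k /negPf ki]; last first.
  by rewrite !mxE eqxx ki mul0r.
by rewrite !mxE !eqxx addr0 mul1r.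
Qed.

Lemma inner_ge0 x : 0 <= inner x x.
Proof. by apply: sumr_ge0 => i _; rewrite -expr2 sqr_ge0. Qed.

Lemma inner_eq0 x : inner x x = 0 -> x = 0.
Proof.
move/eqP; rewrite psumr_eq0 => [/allP x0|i _]; last by rewrite -expr2 sqr_ge0.
apply/rowP => i; have := x0 i (mem_index_enum i).
by rewrite mxE /= mulf_eq0 orbb => /eqP.
Qed.

Lemma Cauchy_Schwarz x y : inner x y ^+ 2 <= inner x x * inner y y.
Proof.
have [y0|y0] := eqVneq (inner y y) 0.
  by rewrite (inner_eq0 y0) !inner0r expr0n mulr0.
have yy : 0 < inner y y by rewrite lt_neqAle eq_sym y0 inner_ge0.
have := inner_ge0 (inner y y *: x + (- inner x y) *: y).
rewrite !innerDl !innerDr !innerZl !innerZr (innerC y x) => h.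
by rewrite -subr_ge0 -(pmulr_rge0 _ yy); lra.
Qed.

Lemma bracket_sqr x : bracket x ^+ 2 = 1 + inner x x.
Proof.
rewrite /bracket /enorm (sqr_sqrtr (inner_ge0 x)) sqr_sqrtr//.
by rewrite addr_ge0// inner_ge0.
Qed.

Lemma bracket_gt0 x : 0 < bracket x.
Proof. by rewrite sqrtr_gt0 ltr_wpDr ?sqr_ge0. Qed.

Lemma bracket0 : bracket (0 : 'rV[R]_n) = 1.
Proof.
apply/eqP; rewrite -(@eqrXn2 _ 2)// ?ltW ?bracket_gt0//.
by rewrite bracket_sqr inner0l addr0 expr1n.
Qed.

(** The Lorentz form, time coordinate counted positively, of the lifts of [x] and [y] to the
    hyperboloid; it is the hyperbolic cosine of their distance. *)
Definition mink x y : R := bracket x * bracket y - inner x y.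

Lemma minkC x y : mink x y = mink y x.
Proof. by rewrite /mink mulrC innerC. Qed.

Lemma mink0 x : mink x 0 = bracket x.
Proof. by rewrite /mink bracket0 mulr1 inner0r subr0. Qed.

(** After squaring, [(1 + inner x y) ^+ 2 <= (1 + inner x x) * (1 + inner y y)] is the sum of
    Cauchy-Schwarz and the nonnegativity of the squared norm of [x - y]. *)
Lemma mink_ge1 x y : 1 <= mink x y.
Proof.
rewrite /mink lerBrDr; apply: le_trans (ler_norm _) _.
rewrite -[leRHS]gtr0_norm ?mulr_gt0 ?bracket_gt0//.
rewrite -ler_sqr ?nnegrE// !real_normK ?num_real// exprMn !bracket_sqr.
have := Cauchy_Schwarz x y; have := inner_ge0 (x + (-1) *: y).
by rewrite !innerDl !innerDr !innerZl !innerZr (innerC y x); lra.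
Qed.

(* With [P, Q, M] the lifts to the hyperboloid, [P + Q - 2 * C * M] is isotropic
   and orthogonal to the timelike vector [M], hence zero. *)
Lemma mink_midpoint p q m r (C : R) :
  mink p m = C -> mink q m = C -> mink p q = 2 * C ^+ 2 - 1 ->
  mink p r + mink q r = 2 * C * mink m r.
Proof.
rewrite /mink => pm qm pq.
pose v := p + q + (- 2 * C) *: m.
pose v0 := bracket p + bracket q - 2 * C * bracket m.
have vm : inner v m = v0 * bracket m.
  rewrite /v /v0 !innerDl innerZl; have := bracket_sqr m; nra.
have vv : inner v v = v0 ^+ 2.
  rewrite /v /v0 !innerDl !innerDr !innerZl !innerZr.
  rewrite !(innerC m) (innerC q p).
  have := bracket_sqr m; have := bracket_sqr p; have := bracket_sqr q.
  move: (bracket _) (bracket _) (bracket _) pm qm pq => bq bp bm.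
  by move=> pm qm pq hq hp hm; nra.
(* Cauchy-Schwarz for [v] and [m] reads [v0 ^+ 2 * (1 + inner m m) <= v0 ^+ 2 * inner m m]. *)
have v00 : v0 = 0.
  apply/eqP; rewrite -sqrf_eq0 eq_le sqr_ge0 andbT.
  have := Cauchy_Schwarz v m; rewrite vm vv exprMn bracket_sqr.
  by lra.
have vr : inner v r = 0.
  by rewrite (@inner_eq0 v) ?inner0l// vv v00 expr0n.
move: vr; rewrite /v !innerDl innerZl.
have : v0 * bracket r = 0 by rewrite v00 mul0r.
by rewrite /v0; lra.
Qed.

(** * Maps preserving the Lorentz form, in matrix terms *)

Definition hyp_lift x : 'rV[R]_(1 + n) := row_mx (bracket x)%:M x.

Definition minkmx : 'M[R]_(1 + n) := block_mx 1%:M 0 0 (- 1%:M).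

Lemma minkmx_sqr : minkmx *m minkmx = 1%:M.
Proof.
rewrite mulmx_block !(mul0mx, mulmx0, mulmx1, addr0, add0r) mulNmx mul1mx opprK.
by rewrite -scalar_mx_block.
Qed.

Lemma mul_minkmx (a b : R) x y :
  row_mx a%:M x *m minkmx *m (row_mx b%:M y)^T = (a * b - inner x y)%:M.
Proof.
rewrite mul_row_block !(mulmx0, mulmx1, addr0, add0r) mulmxN mulmx1.
rewrite tr_row_mx mul_row_col tr_scalar_mx -scalar_mxM mulNmx.
have -> : x *m y^T = (inner x y)%:M.
  by rewrite [LHS]mx11_scalar mxE; congr _%:M; apply: eq_bigr => i _; rewrite mxE.
by rewrite -raddfN -raddfD.
Qed.

Lemma row_mx_scalar0 a x : (row_mx a%:M x : 'rV[R]_(1 + n)) 0 0 = a.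
Proof.
transitivity ((row_mx a%:M x : 'rV[R]_(1 + n)) 0 (lshift n 0)).
  by congr (row_mx _ _ _ _); exact/val_inj.
by rewrite row_mxEl mxE.
Qed.

Lemma hyp_lift_mink x y : hyp_lift x *m minkmx *m (hyp_lift y)^T = (mink x y)%:M.
Proof. exact: mul_minkmx. Qed.

(** The lift of the origin is the unit time vector, so pairing with it reads off the time
    coordinate. *)
Lemma mul_minkmx_hyp_lift0 (Z : 'rV[R]_(1 + n)) :
  (Z *m minkmx *m (hyp_lift 0)^T) 0 0 = Z 0 0.
Proof.
rewrite -(hsubmxK Z) (mx11_scalar (lsubmx Z)) mul_minkmx row_mx_scalar0.
by rewrite inner0r bracket0 mxE eqxx mulr1n mulr1 subr0.
Qed.

Lemma hyp_lift_inj x y : hyp_lift x = hyp_lift y -> x = y.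
Proof. by move/eq_row_mx => []. Qed.

Lemma hyp_liftP (Z : 'rV[R]_(1 + n)) :
  Z *m minkmx *m Z^T = 1%:M -> 0 < Z 0 0 -> exists x, Z = hyp_lift x.
Proof.
rewrite -(hsubmxK Z) (mx11_scalar (lsubmx Z)).
move: (lsubmx Z 0 0) (rsubmx Z) => a x.
rewrite row_mx_scalar0 mul_minkmx => /(congr1 (fun M : 'M[R]_1 => M 0 0)).
rewrite !mxE eqxx !mulr1n => ax a0.
exists x; congr (row_mx _%:M _).
apply/eqP; rewrite -(@eqrXn2 _ 2)// ?ltW ?bracket_gt0//.
by rewrite bracket_sqr; apply/eqP; lra.
Qed.

Lemma gram_entry (A : 'M[R]_(1 + n)) i j :
  (A *m minkmx *m A^T) i j = (row i A *m minkmx *m (row j A)^T) 0 0.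
Proof. by rewrite !mxE; apply: eq_bigr => k _; rewrite -row_mul !mxE. Qed.

(** The origin and the standard basis vectors: [1 + n] points whose lifts form a basis of the
    ambient space. *)
Definition frame (i : 'I_(1 + n)) : 'rV[R]_n :=
  match fintype.split i with inl _ => 0 | inr j => delta_mx 0 j end.

Lemma frame_unit : (\matrix_i hyp_lift (frame i)) \in unitmx.
Proof.
suff -> : \matrix_i hyp_lift (frame i) =
    block_mx 1%:M 0 (\col_j bracket (delta_mx 0 j)) 1%:M.
  by rewrite unitmxE det_lblock !det1 mulr1 unitr1.
apply/row_matrixP => i; rewrite rowK /frame block_mxEv.
case: split_ordP => j ->.
  by rewrite rowKu row_id /hyp_lift bracket0.
rewrite rowKd row_row_mx /hyp_lift row1; congr (row_mx _ _).
by apply/rowP => k; rewrite !mxE !ord1 eqxx.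
Qed.

(** [L] is defined by sending the lifted frame to the lifts of its images. Equal Gram matrices make
    [L] Lorentz, and a vector is determined by its products with the image frame. *)
Lemma mink_preserving_linear (u : 'rV[R]_n -> 'rV[R]_n) :
  (forall x y, mink (u x) (u y) = mink x y) ->
  exists L : 'M[R]_(1 + n),
    L *m minkmx *m L^T = minkmx /\ forall x, hyp_lift (u x) = hyp_lift x *m L.
Proof.
move=> uM; pose A := \matrix_i hyp_lift (frame i); pose A' := \matrix_i hyp_lift (u (frame i)).
have Au : A \in unitmx by exact: frame_unit.
have gram : A' *m minkmx *m A'^T = A *m minkmx *m A^T.
  by apply/matrixP => i j; rewrite !gram_entry !rowK !hyp_lift_mink uM.
pose L := invmx A *m A'.
have AL : A *m L = A' by rewrite mulKVmx.
have LJ : L *m minkmx *m L^T = minkmx.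
  rewrite /L trmx_mul !mulmxA -[invmx A *m A' *m _]mulmxA.
  rewrite -[invmx A *m (A' *m _) *m _]mulmxA gram !mulmxA mulVmx// mul1mx.
  by rewrite -mulmxA -trmx_mul mulVmx// trmx1 mulmx1.
exists L; split=> // x.
(* The Lorentz relation exhibits [minkmx *m L^T *m minkmx] as a right inverse of the square matrix
   [L], hence also a left inverse. *)
have LJV : minkmx *m L^T *m minkmx *m L = 1%:M.
  apply: mulmx1C; rewrite !mulmxA LJ; exact: minkmx_sqr.
(* Tested against the basis [A], both sides have entries [mink x (frame j)]. *)
have ux : hyp_lift (u x) *m minkmx *m L^T = hyp_lift x *m minkmx.
  have Atu : A^T \in unitmx by rewrite unitmx_tr.
  apply: (can_inj (mulmxK Atu)); rewrite /mulmxr /=.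
  rewrite -(mulmxA _ L^T) -trmx_mul AL; apply/matrixP => i j; rewrite ord1.
  have entry (w : 'rV[R]_(1 + n)) (B : 'M[R]_(1 + n)) :
      (w *m B^T) 0 j = (w *m (row j B)^T) 0 0.
    by rewrite !mxE; apply: eq_bigr => k _; rewrite !mxE.
  by rewrite !entry !rowK !hyp_lift_mink uM.
by rewrite -[LHS]mulmx1 -LJV !mulmxA ux -(mulmxA (hyp_lift x)) minkmx_sqr mulmx1.
Qed.

(** The preimage of the lift of [y] under [L] has Lorentz norm 1, and its time coordinate is
    [mink y (u 0) >= 1]; so it lies on the upper sheet and is itself a lift. *)
Lemma mink_preserving_surj (u : 'rV[R]_n -> 'rV[R]_n) :
  (forall x y, mink (u x) (u y) = mink x y) -> forall y, exists x, u x = y.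
Proof.
move=> uM y; have [L [LJ uL]] := mink_preserving_linear uM.
have LJV : minkmx *m L^T *m minkmx *m L = 1%:M.
  by apply: mulmx1C; rewrite !mulmxA LJ minkmx_sqr.
pose Z := hyp_lift y *m minkmx *m L^T *m minkmx.
have ZL : Z *m L = hyp_lift y.
  by rewrite -[RHS]mulmx1 -LJV /Z !mulmxA.
(* The inverse of [L] is its adjoint for the Lorentz form. *)
have ZM w : Z *m minkmx *m w^T = hyp_lift y *m minkmx *m (w *m L)^T.
  by rewrite /Z -[_ *m minkmx *m minkmx]mulmxA minkmx_sqr mulmx1 trmx_mul !mulmxA.
have [||x Zx] := @hyp_liftP Z.
- by rewrite ZM ZL hyp_lift_mink /mink -expr2 bracket_sqr addrK.
- have := ZM _ (hyp_lift 0); rewrite -uL hyp_lift_mink.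
  move/(congr1 (fun M : 'M[R]_1 => M 0 0)); rewrite [RHS]mxE eqxx mulr1n.
  rewrite mul_minkmx_hyp_lift0 => ->.
  by rewrite (lt_le_trans ltr01)// mink_ge1.
by exists x; apply: hyp_lift_inj; rewrite uL -Zx.
Qed.

End Hyperboloid.

(** * The ratio of a dilation *)

Section Dilation.
Variable R : realType.

Lemma cosh_dist_h n (x y : 'rV[R]_n) : cosh (dist_h x y) = mink x y.
Proof. exact/cosh_arcosh/mink_ge1. Qed.

(* The right triangle with vertices [0], [sinh a *: e_1], [sinh b *: e_2] has
   hypotenuse of hyperbolic cosine [cosh a * cosh b], and [0] is the midpoint of
   the leg doubled by reflection. *)
Lemma dilation_cosh_mul n (u : 'rV[R]_n -> 'rV[R]_n) (c : R) :
  (1 < n)%N -> (forall x y, dist_h (u x) (u y) = c * dist_h x y) ->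
  forall s t, 1 <= s -> 1 <= t ->
  cosh (c * arcosh (s * t)) = cosh (c * arcosh s) * cosh (c * arcosh t).
Proof.
move=> n1 uc s t s1 t1; pose F w := cosh (c * arcosh w).
have uF x y : mink (u x) (u y) = F (mink x y) by rewrite -cosh_dist_h uc.
(* Two orthogonal axes, available since [1 < n], carry the legs of the right triangle. *)
pose i : 'I_n := Ordinal (ltnW n1); pose j : 'I_n := Ordinal n1.
have ij : (i == j) = false by [].
pose a := Num.sqrt (s ^+ 2 - 1); pose b := Num.sqrt (t ^+ 2 - 1).
have a2 : a ^+ 2 = s ^+ 2 - 1 by rewrite sqr_sqrtr//; nra.
have b2 : b ^+ 2 = t ^+ 2 - 1 by rewrite sqr_sqrtr//; nra.
have bracket_line d w k : 1 <= w -> d ^+ 2 = w ^+ 2 - 1 ->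
    bracket (d *: delta_mx 0 k : 'rV[R]_n) = w.
  move=> w1 d2; have w0 : 0 <= w by lra.
  apply/eqP; rewrite -(@eqrXn2 _ 2)// ?ltW ?bracket_gt0//.
  by rewrite bracket_sqr innerZl innerZr inner_delta eqxx mulr1; apply/eqP; lra.
pose p : 'rV[R]_n := a *: delta_mx 0 i.
pose q : 'rV[R]_n := (- a) *: delta_mx 0 i.
pose r : 'rV[R]_n := b *: delta_mx 0 j.
have bp : bracket p = s by exact: bracket_line.
have bq : bracket q = s by apply: bracket_line; rewrite ?sqrrN.
have br : bracket r = t by exact: bracket_line.
have pr : mink p r = s * t.
  by rewrite /mink bp br innerZl innerZr inner_delta ij !mulr0 subr0.
have qr : mink q r = s * t.
  by rewrite /mink bq br innerZl innerZr inner_delta ij !mulr0 subr0.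
have pq : mink p q = 2 * s ^+ 2 - 1.
  by rewrite /mink bp bq innerZl innerZr inner_delta eqxx mulr1; lra.
(* The duplication formula for [F] makes [u 0] the midpoint of [u p] and [u q]; the median formula
   then reads [2 * F (s * t) = 2 * F s * F t]. *)
have := @mink_midpoint _ _ (u p) (u q) (u 0) (u r) (F s).
rewrite !uF pr qr pq !mink0 (minkC 0) mink0 bp bq br.
have -> : F (2 * s ^+ 2 - 1) = 2 * F s ^+ 2 - 1.
  by rewrite /F arcosh_double// mulrCA cosh_double.
by move/(_ erefl erefl erefl); rewrite -/(F _) -/(F s) -/(F t); lra.
Qed.

Lemma dilation_ratio n (u : 'rV[R]_n -> 'rV[R]_n) (c : R) :
  (1 < n)%N -> 0 < c -> (forall x y, dist_h (u x) (u y) = c * dist_h x y) -> c = 1.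
Proof.
move=> n1 c0 uc; have c_ge0 := ltW c0.
have arcosh2 : 0 < arcosh (2 : R) by apply: arcosh_gt0; lra.
have : cosh (c * arcosh 2) = 2.
  apply: (multiplicative_doubling_fix2 (F := fun s => cosh (c * arcosh s))).
  - move=> s t s1 st; rewrite cosh_le ?mulr_ge0 ?arcosh_ge0//.
    by rewrite ler_wpM2l// arcosh_le.
  - by move=> s t s1 t1; rewrite (dilation_cosh_mul n1 uc).
  - by move=> s s1; rewrite arcosh_double// mulrCA cosh_double.
  - by rewrite arcosh1 mulr0 cosh0.
  - by rewrite -[ltLHS]cosh0 cosh_lt// mulr_gt0.
(* Injectivity of [cosh] on nonnegative reals gives [c * arcosh 2 = arcosh 2], where [arcosh 2] is
   nonzero. *)
rewrite -[RHS]cosh_arcosh; last by lra.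
move/cosh_inj => /(_ ltac:(exact: mulr_ge0 c_ge0 (ltW arcosh2)) (ltW arcosh2)).
by move=> e; apply: (mulIf (lt0r_neq0 arcosh2)); rewrite mul1r.
Qed.

End Dilation.

Theorem theorem3p5 (R : realType) (n : nat) (u : 'rV[R]_n -> 'rV[R]_n) :
  (1 < n)%N ->
  is_dilation (@dist_h R n) (@dist_h R n) u ->
  is_isometry (@dist_h R n) (@dist_h R n) u.
Proof.
move=> n1 [c c0 uc].
have c1 : c = 1 by exact: dilation_ratio uc.
have ud p q : dist_h (u p) (u q) = dist_h p q by rewrite uc c1 mul1r.
split=> // y _; have [x <-] : exists x, u x = y.
  by apply: mink_preserving_surj => p q; rewrite -!cosh_dist_h ud.
by exists x.
Qed.
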